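(* Let $G:\mathbb{R}\to\mathbb{R}$ be a measurable function that is not a.e. constant, and suppose that $G(\cdot+M)\in L^2(\gamma)$ and $G(\cdot-M)\in L^2(\gamma)$ for some $M>0$. Then $G(\cdot+x)\in L^2(\gamma)$ for all $x\in[-M,M]$, and the interval $(-M,M)$ contains no accumulation point of the set $$E=\{x\in(-M,M):\ G(\cdot+x)\text{ has Hermite rank}\ \ge 2\},$$ that is, $E'\cap(-M,M)=\emptyset$, where $E'$ is the set of all accumulation points of $E$.
   Context: $\gamma(dx)=\phi(x)\,dx$ with $\phi(x)=(2\pi)^{-1/2}e^{-x^2/2}$ is the standard Gaussian measure on $\mathbb{R}$, and $L^2(\gamma)=\{G:\int_{\mathbb{R}}G(z)^2\phi(z)\,dz<\infty\}$. $G(\cdot+x)$ denotes the function $z\mapsto G(z+x)$. ''a.e.'' is with respect to Lebesgue measure. The Hermite polynomials are $H_0(x)=1$ and $H_m(x)=(-1)^m e^{x^2/2}\frac{d^m}{dx^m}e^{-x^2/2}$ for $m\ge1$ (so $H_1(x)=x$, $H_2(x)=x^2-1$). The Hermite rank of $f\in L^2(\gamma)$ is $\inf\{m\ge 1:\int_{\mathbb{R}} f(x)H_m(x)\,\gamma(dx)\ne 0\}$ (with $\inf\emptyset=\infty$). A point $x$ is an accumulation point of a set $E$ if every neighborhood of $x$ contains infinitely many elements of $E$. *)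

(* Defs.v *)
From HB Require Import structures.
From mathcomp Require Import all_boot all_order all_algebra.
From mathcomp Require Import all_classical all_reals all_analysis.

Set Implicit Arguments.
Unset Strict Implicit.
Unset Printing Implicit Defensive.

Import Order.TTheory GRing.Theory Num.Theory.
Import numFieldNormedType.Exports.

Local Open Scope classical_set_scope.
Local Open Scope ring_scope.

(* [normal_pdf 0 1] is phi(x) = (2 pi)^(-1/2) exp(- x^2 / 2), and
   [normal_prob 0 1] is the measure gamma with this density. *)
Definition L2_gaussian (R : realType) (f : R -> R) : Prop :=
  measurable_fun [set: R] f /\
  (\int[lebesgue_measure]_z (f z ^+ 2 * normal_pdf 0 1 z)%:E < +oo)%E.

Definition shift_fun (R : realType) (f : R -> R) (x : R) : R -> R :=
  fun z => f (z + x).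

Definition hermite (R : realType) (m : nat) (x : R) : R :=
  (-1) ^+ m * expR (x ^+ 2 / 2) *
  derive1n m (fun y : R => expR (- (y ^+ 2 / 2))) x.

(* The value +oo, i.e. [ereal_inf set0], is taken when all these integrals
   vanish. The integral is the extended-real one; it is finite for f in
   L^2(gamma). *)
Definition hermite_rank (R : realType) (f : R -> R) : \bar R :=
  ereal_inf [set (m%:R)%:E | m in [set m : nat | (1 <= m)%N /\
    (\int[normal_prob (0 : R) 1]_x (f x * hermite m x)%:E <> 0)%E]].

(* [limit_point] only asks for one other point of E in every neighborhood. *)
Definition accumulation_points (R : realType) (E : set R) : set R :=
  [set x | forall U, nbhs x U -> infinite_set (U `&` E)].

(* Main.v *)
Require Import Defs.
From mathcomp Require Import all_boot all_order all_algebra.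
From mathcomp Require Import all_classical all_reals all_analysis.
From mathcomp Require Import measurable_realfun ring lra.
Import Order.TTheory GRing.Theory Num.Theory.
Import numFieldNormedType.Exports.

(** Let F(x) be the mean of G(. + x) under gamma, that is the integral of G
    against the density of N(x, 1). Integrating by parts, F'(x) is the first
    Hermite coefficient of G(. + x), so the exceptional set E is the zero set
    of F'. Since N(x0 + t, 1) has density exp(t v - t^2/2) with respect to
    N(x0, 1), where v = u - x0, the function F is real-analytic. If the zeros of
    F' accumulate at x0 then F is constant, and the injectivity of the two-sided
    Laplace transform forces G to be a constant almost everywhere.

    The proof below follows this idea with moments in place of derivatives.
    Put w = (G - c) p, with p the density of N(x0, 1) and c the mean of G
    under it. That x0 + t belongs to E says that the integral of
    w (v - t) exp(t v) vanishes. Expanding both terms in powers of t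
    ([exp_moment_expansion]) and dividing by the leading power shows by
    induction that all the moments of w in v vanish
    ([moments_eq0_of_accumulation]).

    It remains to see that such a weight is null ([gauss_null_ae_eq0]).
    Square-integrability of G makes w exp(v^2/8) integrable, so that w may be
    multiplied by exp(- s v^2), for small s and then, iterating, for every
    s >= 0, without creating a nonzero moment; multiplying moreover by exp(b v)
    shows that w is orthogonal to every Gaussian bump exp(- s (u - y)^2). The
    powers of such a bump X are again bumps, hence w is orthogonal to the
    polynomials in X and, in the limit, to the indicator function of
    1/2 <= X ([integral_level_set_eq0]), which is that of an arbitrary compact
    interval. Lebesgue differentiation concludes.

    The first assertion follows from the pointwise bound of the density of
    N(x, 1) by a multiple of the sum of those of N(M, 1) and N(- M, 1)
    ([normal_pdf_interpolation]). *)

Set Implicit Arguments.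
Unset Strict Implicit.

Local Open Scope classical_set_scope.
Local Open Scope ring_scope.

(** * Exponential moments of a weight *)

(** The factor |t|^N serves both the order of vanishing at t = 0 and, for a
    fixed |t| < 1, the convergence as N grows; the exponential of |x|, rather
    than that of |t x|, makes the bound uniform in t. *)
Lemma expR_taylor_le (R : realType) (N : nat) (t x : R) :
  `|t| <= 1 ->
  `|expR (t * x) - \sum_(n < N) (t * x) ^+ n / n`!%:R| <= `|t| ^+ N * expR `|x|.
Proof.
move=> t1.
have tail K : (N <= K)%N ->
    `|series (exp_coeff (t * x)) K - \sum_(n < N) (t * x) ^+ n / n`!%:R| <=
    `|t| ^+ N * series (exp_coeff `|x|) K.
  move=> NK; rewrite /series /exp_coeff /=.
  rewrite -(big_mkord xpredT (fun n => (t * x) ^+ n / n`!%:R)).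
  rewrite (@big_cat_nat _ _ _ N 0 K)//= [X in X - _]addrC addrK.
  rewrite (le_trans (ler_norm_sum _ _ _))//.
  rewrite [in leRHS](@big_cat_nat _ _ _ N 0 K)//= mulrDr.
  rewrite -[leLHS]add0r lerD//.
    by rewrite mulr_ge0// ?sumr_ge0// => i _; rewrite divr_ge0.
  rewrite mulr_sumr ler_sum_nat// => i /andP[Ni _].
  rewrite normrM normrV ?unitfE ?pnatr_eq0 -?lt0n ?fact_gt0//.
  rewrite normrX normrM exprMn normr_nat mulrA ler_wpM2r//.
  by rewrite ler_wpM2r// ?exprn_ge0// ler_wiXn2l.
apply: (@ler_cvg_to _ (nbhs \oo) _ _
  (fun K => `|series (exp_coeff (t * x)) K -
              \sum_(n < N) (t * x) ^+ n / n`!%:R|)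
  (fun K => `|t| ^+ N * series (exp_coeff `|x|) K)).
- apply: cvg_norm; apply: cvgB; last exact: cvg_cst.
  exact: is_cvg_series_exp_coeff.
- by apply: cvgMl_tmp; exact: is_cvg_series_exp_coeff.
- by near=> K; apply: tail; near: K; exact: nbhs_infty_ge.
Unshelve. all: by end_near. Qed.

Section exponential_moments.
Context {d : measure_display} {T : measurableType d} {R : realType}.
Variable mu : {measure set T -> \bar R}.
Implicit Types f g w v : T -> R.

Lemma integrable_dominated f g : measurable_fun setT f ->
  mu.-integrable setT (EFin \o g) -> (forall x, `|f x| <= g x) ->
  mu.-integrable setT (EFin \o f).
Proof.
move=> mf ig fg; apply: le_integrable ig => //; first exact/measurable_EFinP.
by move=> x _; rewrite /= lee_fin (le_trans (fg x))// ler_norm.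
Qed.

Lemma integrable_normr f : mu.-integrable setT (EFin \o f) ->
  mu.-integrable setT (EFin \o (fun x => `|f x|)).
Proof. by move=> /integrable_abse. Qed.

Lemma expn_le_expR n (x : R) : 0 <= x -> x ^+ n <= n`!%:R * expR x.
Proof.
move=> x0; case: n => [|n].
  by rewrite expr0 fact0 mul1r -expR0 ler_expR.
rewrite mulrC -ler_pdivrMr ?ltr0n ?fact_gt0//.
by rewrite (le_trans _ (expR_ge1Dxn n x0))// lerDr.
Qed.

Section weight.
Variables w v : T -> R.
Hypotheses (mw : measurable_fun setT w) (mv : measurable_fun setT v).
Hypothesis iwv : mu.-integrable setT (EFin \o (fun x => w x * expR `|v x|)).

Lemma integrable_moment n :
  mu.-integrable setT (EFin \o (fun x => w x * v x ^+ n)).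
Proof.
have h := integrableZl measurableT n`!%:R (integrable_normr iwv).
apply: (@integrable_dominated _ (fun x => n`!%:R * `|w x * expR `|v x| |)).
- by apply: measurable_funM => //; exact: measurable_funX.
- exact: h.
- move=> x; rewrite !normrM normrX mulrCA ler_wpM2l//.
  by rewrite (ger0_norm (expR_ge0 _)) expn_le_expR.
Qed.

Lemma integrable_exp_weight (t : R) : `|t| <= 1 ->
  mu.-integrable setT (EFin \o (fun x => w x * expR (t * v x))).
Proof.
move=> t1.
apply: (@integrable_dominated _ (fun x => `|w x * expR `|v x| |)).
- apply: measurable_funM => //; apply: measurableT_comp => //.
  exact: measurable_funM.
- exact: integrable_normr.
- move=> x; rewrite !normrM ler_wpM2l// !(ger0_norm (expR_ge0 _)) ler_expR.
  by rewrite (le_trans (ler_norm _))// normrM ler_piMl.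
Qed.

(** Integrated form of [expR_taylor_le]. *)
Lemma exp_moment_expansion N (t : R) : `|t| <= 1 ->
  `|\int[mu]_x (w x * expR (t * v x)) -
    \sum_(n < N) t ^+ n / n`!%:R * \int[mu]_x (w x * v x ^+ n)| <=
  `|t| ^+ N * \int[mu]_x `|w x * expR `|v x| |.
Proof.
move=> t1.
have S : forall N, mu.-integrable setT (EFin \o (fun x =>
      \sum_(n < N) t ^+ n / n`!%:R * (w x * v x ^+ n))) /\
    \sum_(n < N) t ^+ n / n`!%:R * \int[mu]_x (w x * v x ^+ n) =
    \int[mu]_x (\sum_(n < N) t ^+ n / n`!%:R * (w x * v x ^+ n)).
  elim=> [|k [ik IH]].
    under [in X in X /\ _]eq_fun do rewrite big_ord0.
    split; first exact: integrable0.
    by under [RHS]eq_Rintegral do rewrite big_ord0;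
       rewrite big_ord0 Rintegral_cst// mul0r.
  have i2 : mu.-integrable setT (EFin \o
      (fun x => t ^+ k / k`!%:R * (w x * v x ^+ k))).
    exact: (integrableZl measurableT _ (integrable_moment k)).
  split.
    under [in X in integrable _ _ X]eq_fun do rewrite big_ord_recr/=.
    exact: (integrableD measurableT ik i2).
  rewrite big_ord_recr/= IH.
  under [RHS]eq_Rintegral do rewrite big_ord_recr/=.
  by rewrite RintegralD// RintegralZl//; exact: integrable_moment.
have [iS ->] := S N.
have ie := integrable_exp_weight t1.
rewrite -RintegralB//.
apply: le_trans (le_normr_Rintegral _ _) _ => //.
  exact: (integrableB measurableT ie iS).
rewrite -RintegralZl//; last exact: integrable_normr.
apply: le_Rintegral => //.
- apply: integrable_normr; exact: (integrableB measurableT ie iS).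
- exact: (integrableZl measurableT _ (integrable_normr iwv)).
- move=> x _.
  rewrite (_ : w x * _ - _ =
     w x * (expR (t * v x) - \sum_(n < N) (t * v x) ^+ n / n`!%:R)); last first.
    rewrite mulrBr mulr_sumr; congr (_ - _); apply: eq_bigr => i _.
    by rewrite exprMn; ring.
  rewrite !normrM mulrCA ler_wpM2l// (ger0_norm (expR_ge0 _)).
  exact: expR_taylor_le.
Qed.

(** The condition |t| < 1 is a matter of normalization: it is met by scaling
    [v], at the price of the integrability of [w] against a larger
    exponential. *)
Lemma exp_transform_eq0 (t : R) : `|t| < 1 ->
  (forall n, \int[mu]_x (w x * v x ^+ n) = 0) ->
  \int[mu]_x (w x * expR (t * v x)) = 0.
Proof.
move=> t1 w0; apply/eqP; rewrite -normr_le0.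
have /= c : (fun N => `|t| ^+ N * \int[mu]_x `|w x * expR `|v x| |) @ \oo -->
    (0 : R).
  rewrite -[X in _ --> X](mul0r (\int[mu]_x `|w x * expR `|v x| |)).
  by apply: cvgMr_tmp; apply: cvg_expr; rewrite normr_id.
rewrite -(cvg_lim _ c)//; apply: limr_ge; first by apply/cvg_ex; exists 0.
near=> N; have := exp_moment_expansion N (ltW t1).
by rewrite big1 ?subr0// => i _; rewrite w0 mulr0.
Unshelve. all: by end_near. Qed.

End weight.
End exponential_moments.

(** * Orthogonality to powers and level sets *)

Lemma bernoulli_le (R : realType) (N : nat) (x : R) : 0 <= x <= 1 ->
  1 - N%:R * x <= (1 - x) ^+ N.
Proof.
move=> /andP[x0 x1]; elim: N => [|N IH]; first by rewrite mul0r subr0 expr0.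
rewrite exprS; have := ler_wpM2l (_ : 0 <= 1 - x) IH.
rewrite subr_ge0 => /(_ x1); apply: le_trans.
rewrite -subr_ge0 (_ : _ - _ = N%:R * x ^+ 2); last by rewrite -natr1; ring.
by rewrite mulr_ge0// sqr_ge0.
Qed.

(** With y = exp(- c), the quadratic term of exp(n c) bounds n y^n by
    2 / (c^2 n). *)
Lemma cvg_natr_expr (R : realType) (y : R) : 0 <= y < 1 ->
  (fun n => n%:R * y ^+ n) @ \oo --> (0 : R).
Proof.
move=> /andP[]; rewrite le_eqVlt => /predU1P[<- _|y0 y1].
  apply: cvg_near_cst; near=> n; rewrite expr0n gtn_eqF ?mulr0//.
  by near: n; exact: nbhs_infty_gt.
pose c := - ln y.
have c0 : 0 < c by rewrite oppr_gt0 ln_lt0// y0.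
have yE n : y ^+ n = expR (- (n%:R * c)).
  by rewrite -mulrN opprK expRM_natl lnK.
apply: (@squeeze_cvgr _ \oo _ _ (cst 0) (fun n => (2 / c ^+ 2) * n%:R^-1) _).
- near=> n; have n0 : (0 : R) < n%:R.
    by rewrite ltr0n; near: n; exact: nbhs_infty_gt.
  apply/andP; split; first by rewrite /= mulr_ge0// exprn_ge0// ltW.
  have z0 : 0 < n%:R * c by rewrite mulr_gt0.
  have h : (n%:R * c) ^+ 2 / 2 <= expR (n%:R * c).
    by rewrite (le_trans _ (expR_ge1Dxn 1 (ltW z0)))// lerDr.
  rewrite yE expRN ler_pdivrMr ?expR_gt0//.
  apply: le_trans (ler_wpM2l _ h); last first.
    by rewrite !mulr_ge0 ?invr_ge0 ?exprn_ge0 ?ltW.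
  rewrite le_eqVlt; apply/orP; left; apply/eqP.
  by field; rewrite !gt_eqF.
- exact: cvg_cst.
- rewrite -[X in _ --> X](mulr0 (2 / c ^+ 2)); apply: cvgMl_tmp.
  apply: (gtr0_cvgV0 _).2; last exact: cvgr_idn.
  by near=> n; rewrite ltr0n; near: n; exact: nbhs_infty_gt.
Unshelve. all: by end_near. Qed.

(** By the Bernoulli inequality the sequence is at least 1 - n (2 x)^n, which
    tends to 1 when x < 1/2; and it is at most exp(- n (2 x)^n), which is at
    most exp(- n) when 1/2 <= x. The factor n in the exponent n 2^n is there for
    the threshold x = 1/2 itself, where (1 - 2^-n)^(2^n) would tend to
    exp(- 1). *)
Lemma cvg_half_threshold (R : realType) (x : R) : 0 <= x <= 1 ->
  (fun n => (1 - x ^+ n) ^+ (n * 2 ^ n)) @ \oo --> ((x < 1 / 2)%R%:R : R).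
Proof.
move=> /andP[x0 x1].
have xn n : 0 <= x ^+ n <= 1 by rewrite exprn_ge0 ?exprn_ile1.
have sub01 n : 0 <= 1 - x ^+ n <= 1.
  by have /andP[? ?] := xn n; rewrite subr_ge0 gerBl; apply/andP.
have [x2|x2] := ltP x (1 / 2).
- apply: (@squeeze_cvgr _ \oo _ _ (fun n => 1 - n%:R * (2 * x) ^+ n) (cst 1)).
  + near=> n; rewrite exprn_ile1; [|by case/andP: (sub01 n)..].
    rewrite andbT (le_trans _ (bernoulli_le _ (xn n)))//.
    by rewrite natrM natrX exprMn mulrA.
  + rewrite -[X in _ --> X]subr0; apply: cvgB; first exact: cvg_cst.
    by apply: cvg_natr_expr; apply/andP; split; lra.
  + exact: cvg_cst.
- apply: (@squeeze_cvgr _ \oo _ _ (cst 0) (fun n => expR (-1) ^+ n)).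
  + near=> n; have /andP[s0 s1] := sub01 n; rewrite exprn_ge0//=.
    have h : 1 - x ^+ n <= expR (- (x ^+ n)) by exact: expR_ge1Dx.
    rewrite (le_trans (lerXn2r _ _ _ h)) ?nnegrE ?expR_ge0//.
    rewrite -!expRM_natl ler_expR mulrN mulrN1 lerN2 natrM natrX -mulrA -exprMn.
    by rewrite ler_peMr// exprn_ege1//; lra.
  + exact: cvg_cst.
  + apply: cvg_expr; rewrite ger0_norm ?expR_ge0// expR_lt1; lra.
Unshelve. all: by end_near. Qed.

Section level_sets.
Context {d : measure_display} {T : measurableType d} {R : realType}.
Variable mu : {measure set T -> \bar R}.
Variables w X : T -> R.
Hypotheses (iw : mu.-integrable setT (EFin \o w)).
Hypotheses (mX : measurable_fun setT X) (X01 : forall x, 0 <= X x <= 1).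

(** The polynomials (1 - X^n)^(n 2^n) lie in [0, 1] and converge everywhere to
    the indicator function of X < 1/2, so dominated convergence carries the
    orthogonality over to this indicator. *)
Lemma integral_level_set_eq0 :
  (forall n, \int[mu]_x (w x * X x ^+ n) = 0) ->
  \int[mu]_(x in [set x | 1 / 2 <= X x]) w x = 0.
Proof.
move=> w0.
have mw : measurable_fun setT w by exact/measurable_EFinP/(measurable_int mu).
have X0 x : 0 <= X x by case/andP: (X01 x).
have X1 x : X x <= 1 by case/andP: (X01 x).
have s01 n x : 0 <= 1 - X x ^+ n <= 1.
  by rewrite subr_ge0 gerBl exprn_ge0 ?exprn_ile1.
have mf n N k : measurable_fun setT
    (fun x => w x * (X x ^+ k * (1 - X x ^+ n) ^+ N)).
  apply: measurable_funM => //.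
  apply: measurable_funM; first exact: measurable_funX.
  apply: measurable_funX; apply: measurable_funB => //; exact: measurable_funX.
have fle n N k x : `|w x * (X x ^+ k * (1 - X x ^+ n) ^+ N)| <= `|w x|.
  have /andP[s0 s1] := s01 n x.
  rewrite normrM ler_piMr// ger0_norm ?mulr_ge0 ?exprn_ge0//.
  by rewrite mulr_ile1 ?exprn_ge0 ?exprn_ile1.
have fi n N k : mu.-integrable setT
    (EFin \o (fun x => w x * (X x ^+ k * (1 - X x ^+ n) ^+ N))).
  exact: integrable_dominated (integrable_normr iw) (fle n N k).
have I0 n N k : \int[mu]_x (w x * (X x ^+ k * (1 - X x ^+ n) ^+ N)) = 0.
  elim: N k => [|N IH] k.
    by rewrite -(w0 k); apply: eq_Rintegral => x _; rewrite expr0 mulr1.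
  transitivity (\int[mu]_x (w x * (X x ^+ k * (1 - X x ^+ n) ^+ N) -
      w x * (X x ^+ (k + n) * (1 - X x ^+ n) ^+ N))).
    by apply: eq_Rintegral => x _; rewrite exprS exprD; ring.
  by rewrite RintegralB// !IH subr0.
have mlt : measurable [set x | X x < 1 / 2].
  rewrite (_ : [set x | _] = setT `&` X @^-1` [set` `]-oo, (1 / 2)[]); last first.
    by apply/seteqP; split => x /=; rewrite in_itv//= => -[].
  by apply: mX => //; exact: measurable_itv.
have mge : measurable [set x | 1 / 2 <= X x].
  rewrite (_ : [set x | _] = setT `&` X @^-1` [set` `[1 / 2, +oo[]); last first.
    by apply/seteqP; split => x /=; rewrite in_itv/= andbT// => -[].
  by apply: mX => //; exact: measurable_itv.
pose f_ (n : nat) x := (w x * (X x ^+ 0 * (1 - X x ^+ n) ^+ (n * 2 ^ n)))%:E.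
pose f x := (w x * (X x < 1 / 2)%R%:R)%:E.
have [] := @dominated_convergence _ T R mu setT measurableT f_ f
  (fun x => `|w x|%:E).
- by move=> n; apply/measurable_EFinP; exact: mf.
- apply/measurable_EFinP; apply: measurable_funM => //.
  rewrite (_ : (fun _ => _) = \1_[set x | X x < 1 / 2])//.
  by apply/funext => x; rewrite indicE mem_setE.
- apply: aeW => x _; apply: cvg_EFin; first exact: nearW.
  apply: cvgMl_tmp.
  under eq_fun do rewrite /f_ expr0 mul1r.
  exact: cvg_half_threshold.
- exact: integrable_normr.
- by apply: aeW => x n _; rewrite lee_fin; exact: fle.
move=> ifn _.
have -> : [sequence (\int[mu]_x f_ n x)%E]_n = cst 0%E.
  apply/funext => n /=; rewrite -[LHS]fineK.
    by congr EFin; exact: I0.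
  exact: integrable_fin_num (fi _ _ _).
move=> c0; have {}c0 : (\int[mu]_x f x = 0)%E.
  by apply: cvg_unique c0 (cvg_cst _).
have lt0 : \int[mu]_(x in [set x | X x < 1 / 2]) w x = 0.
  rewrite Rintegral_mkcond /Rintegral -[RHS]/(fine 0%E) -c0.
  congr fine; apply: eq_integral => x _.
  rewrite /f patchE; have [h|h] := boolP (X x < 1 / 2).
    by rewrite mem_set// mulr1.
  by rewrite memNset ?mulr0//; exact/negP.
have wT : \int[mu]_x w x = 0.
  by rewrite -(w0 0%N); apply: eq_Rintegral => x _; rewrite mulr1.
have TE : setT = [set x | X x < 1 / 2] `|` [set x | 1 / 2 <= X x].
  by apply/seteqP; split => // x _ /=; have [] := ltP (X x) (1 / 2); [left|right].
move: wT; rewrite TE Rintegral_setU//; last 2 first.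
- by rewrite -TE.
- by apply/disj_setPS => x [/=]; rewrite ltNge => /negP.
by rewrite lt0 add0r.
Qed.

End level_sets.

(** * A weight with Gaussian decay is determined by its moments *)

(** |x|^n is at most n! exp |x|, and (c + 1) |x| is at most
    e x^2 + (c + 1)^2 / (4 e) by completing the square. *)
Lemma gauss_bound (R : realType) (n : nat) (c e x : R) : 0 <= c -> 0 < e ->
  `|x| ^+ n * expR (c * `|x|) <=
  n`!%:R * expR ((c + 1) ^+ 2 / (4 * e)) * expR (e * x ^+ 2).
Proof.
move=> c0 e0; apply: (@le_trans _ _ (n`!%:R * expR `|x| * expR (c * `|x|))).
  by rewrite ler_wpM2r ?expR_ge0// expn_le_expR.
rewrite -!mulrA ler_wpM2l// -!expRD ler_expR -(real_normK (num_real x)) -subr_ge0.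
set y := `|x|.
rewrite (_ : _ - _ = (2 * e * y - (c + 1)) ^+ 2 / (4 * e)).
  by rewrite divr_ge0 ?sqr_ge0// mulr_ge0// ltW.
by field; rewrite gt_eqF.
Qed.

Section gaussian_weight.
Context {d : measure_display} {T : measurableType d} {R : realType}.
Variable mu : {measure set T -> \bar R}.
Variable v : T -> R.
Hypothesis mv : measurable_fun setT v.
Implicit Types w : T -> R.

Lemma integrable_gauss_moment w (e c : R) n : 0 < e -> 0 <= c ->
  measurable_fun setT w ->
  mu.-integrable setT (EFin \o (fun x => w x * expR (e * v x ^+ 2))) ->
  mu.-integrable setT
    (EFin \o (fun x => w x * v x ^+ n * expR (c * `|v x|))).
Proof.
move=> e0 c0 mw iw; pose C := n`!%:R * expR ((c + 1) ^+ 2 / (4 * e)).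
apply: (@integrable_dominated _ _ _ _ _
    (fun x => C * `|w x * expR (e * v x ^+ 2)|)).
- apply: measurable_funM.
    by apply: measurable_funM => //; exact: measurable_funX.
  apply: measurableT_comp => //; apply: measurable_funM => //.
  exact: measurableT_comp.
- exact: (integrableZl measurableT C (integrable_normr iw)).
- move=> x; rewrite !normrM normrX !(ger0_norm (expR_ge0 _)) mulrCA -mulrA.
  by rewrite ler_wpM2l// gauss_bound.
Qed.

(** The rate [e] of decay is kept apart from [w] because it has to stay the same
    when [w] is multiplied by exp(- s v^2): this is what allows iteration. *)
Definition gauss_null (e : R) w := [/\ measurable_fun setT w,
  mu.-integrable setT (EFin \o (fun x => w x * expR (e * v x ^+ 2))) &
  forall n, \int[mu]_x (w x * v x ^+ n) = 0].

Lemma integrable_gauss_null_moment e w n : 0 < e -> gauss_null e w ->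
  mu.-integrable setT (EFin \o (fun x => w x * v x ^+ n)).
Proof.
move=> e0 [mw iw _]; have := integrable_gauss_moment n e0 (lexx 0) mw iw.
rewrite (_ : (fun x => w x * v x ^+ n * _) = (fun x => w x * v x ^+ n))//.
by apply/funext => x; rewrite mul0r expR0 mulr1.
Qed.

(** Against w v^n, every term in the expansion of exp(- s v^2) integrates to a
    multiple of a moment of [w]. The expansion may be integrated only for s small
    with respect to [e]: half of the decay pays for v^n and the other half for
    the doubled exponent 2 s, which puts the expansion at the interior
    point 1/2. *)
Lemma gauss_null_step e s w : 0 < e -> 0 <= s <= e / 4 ->
  gauss_null e w -> gauss_null e (fun x => w x * expR (- (s * v x ^+ 2))).
Proof.
move=> e0 /andP[s0 se] H; have [mw iw w0] := H.
have mvn n : measurable_fun setT (fun x => v x ^+ n) by exact: measurable_funX.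
have mex k : measurable_fun setT (fun x => expR (k * v x ^+ 2)).
  by apply: measurableT_comp => //; exact: measurable_funM.
have mexN k : measurable_fun setT (fun x => expR (- (k * v x ^+ 2))).
  by under eq_fun do rewrite -mulNr; exact: mex.
split.
- exact: measurable_funM.
- apply: (@integrable_dominated _ _ _ _ _ (fun x => `|w x * expR (e * v x ^+ 2)|)).
  + by apply: measurable_funM => //; exact: measurable_funM.
  + exact: integrable_normr.
  + move=> x; rewrite !normrM !(ger0_norm (expR_ge0 _)) ler_wpM2r ?expR_ge0//.
    by rewrite ler_piMr// expR_le1 oppr_le0 mulr_ge0// sqr_ge0.
- move=> n.
  have iw2 : mu.-integrable setT
    (EFin \o (fun x =>
      w x * expR (e / 2 * v x ^+ 2) * expR (e / 2 * v x ^+ 2))).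
    rewrite (_ : (fun x => _) = (fun x => w x * expR (e * v x ^+ 2)))//.
    by apply/funext => x; rewrite -mulrA -expRD; congr (_ * expR _); field.
  have e20 : 0 < e / 2 by rewrite divr_gt0.
  have iw3 := integrable_gauss_moment n e20 (lexx 0)
    (measurable_funM mw (mex (e / 2))) iw2.
  have := @exp_transform_eq0 _ _ _ mu (fun x => w x * v x ^+ n)
    (fun x => - (2 * s * v x ^+ 2)) _ _ _ (1 / 2) _ _.
  under eq_Rintegral => x _.
    rewrite (_ : _ * expR _ = w x * expR (- (s * v x ^+ 2)) * v x ^+ n); last first.
      by rewrite mulrAC; congr (_ * expR _ * _); field.
    over.
  apply.
  + exact: measurable_funM.
  + by apply: measurableT_comp => //; exact: measurable_funM.
  + apply: integrable_dominated (integrable_normr iw3) _.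
      apply: measurable_funM; first exact: measurable_funM.
      apply: measurableT_comp => //; apply: measurableT_comp => //.
      by apply: measurableT_comp => //; exact: measurable_funM.
    move=> x; rewrite mul0r expR0 mulr1 mulrAC !normrM normrX.
    rewrite ler_wpM2r ?exprn_ge0// ler_wpM2l// !(ger0_norm (expR_ge0 _)) ler_expR.
    rewrite normrN ger0_norm; first by rewrite ler_wpM2r ?sqr_ge0//; lra.
    by rewrite mulr_ge0 ?sqr_ge0// mulr_ge0.
  + rewrite ger0_norm; lra.
  + move=> k; rewrite -[RHS](mulr0 ((- (2 * s)) ^+ k)) -(w0 (n + 2 * k)%N).
    rewrite -RintegralZl//; last exact: integrable_gauss_null_moment H.
    by apply: eq_Rintegral => x _; rewrite -mulNr exprMn exprD exprM; ring.
Qed.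

(** An arbitrary s is reached by finitely many steps of length at most e/4. *)
Lemma gauss_null_expR e s w : 0 < e -> 0 <= s ->
  gauss_null e w -> gauss_null e (fun x => w x * expR (- (s * v x ^+ 2))).
Proof.
move=> e0 s0 H; have [N sN] : exists N : nat, s <= N.+1%:R * (e / 4).
  exists (Num.truncn (s / (e / 4))); rewrite -ler_pdivrMr ?divr_gt0//.
  by rewrite ltW// truncnS_gt.
pose s' := s / N.+1%:R.
have s's : 0 <= s' <= e / 4.
  by rewrite divr_ge0//= ler_pdivrMr ?ltr0n// mulrC.
have IH : forall k, gauss_null e (fun x => w x * expR (- (k%:R * s' * v x ^+ 2))).
  elim=> [|k IH].
    rewrite (_ : (fun x => _) = w)//.
    by apply/funext => x; rewrite !mul0r oppr0 expR0 mulr1.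
  have := gauss_null_step e0 s's IH.
  rewrite (_ : (fun x => _ * _ * _) =
    (fun x => w x * expR (- (k.+1%:R * s' * v x ^+ 2))))//.
  apply/funext => x; rewrite -mulrA -expRD; congr (_ * expR _).
  by rewrite -natr1; ring.
have := IH N.+1; rewrite (_ : (fun x => _) =
  (fun x => w x * expR (- (s * v x ^+ 2))))//.
by apply/funext => x; rewrite /s' [_ * (s / _)]mulrC divfK ?pnatr_eq0.
Qed.

(** Moments of w exp(- s v^2) vanish by [gauss_null_expR], and exp(b v) has an
    everywhere convergent expansion that the Gaussian decay dominates. *)
Lemma gauss_null_exp_transform e s b w : 0 < e -> 0 <= s -> gauss_null e w ->
  \int[mu]_x (w x * expR (- (s * v x ^+ 2)) * expR (b * v x)) = 0.
Proof.
move=> e0 s0 /(gauss_null_expR e0 s0); set W := fun x => _ * _ => H.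
have [mW iW W0] := H.
have := @exp_transform_eq0 _ _ _ mu W (fun x => 2 * b * v x) _ _ _ (1 / 2) _ _.
under eq_Rintegral => x _.
  rewrite (_ : 1 / 2 * (2 * b * v x) = b * v x); last by field.
  over.
apply => //.
- exact: measurable_funM.
- have c0 : 0 <= `|2 * b| by [].
  have := integrable_gauss_moment 0 e0 c0 mW iW.
  rewrite (_ : (fun x => W x * _ * _) = (fun x => W x * expR `|2 * b * v x|))//.
  by apply/funext => x; rewrite expr0 mulr1 (normrM _ (v x)).
- rewrite ger0_norm; lra.
- move=> n; rewrite -[RHS](mulr0 ((2 * b) ^+ n)) -(W0 n) -RintegralZl//; last first.
    exact: integrable_gauss_null_moment H.
  by apply: eq_Rintegral => x _; rewrite exprMn; ring.
Qed.

End gaussian_weight.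

Section determinacy.
Context {R : realType}.
Notation mu := (@lebesgue_measure R).
Implicit Types (w : R -> R) (a e y r : R).

(** For s = ln 2 / r^2 the bump X = exp(- s (u - y)^2) is at least 1/2 exactly
    on the closed ball, and X^n is the bump with parameter n s. *)
Lemma integral_ball_eq0 w y : mu.-integrable setT (EFin \o w) ->
  (forall s, 0 <= s -> \int[mu]_u (w u * expR (- (s * (u - y) ^+ 2))) = 0) ->
  forall r, 0 < r -> (\int[mu]_(u in ball y r) (w u)%:E = 0)%E.
Proof.
move=> iw w0 r r0; have ln20 : 0 < ln 2 :> R by rewrite ln_gt0// ltr1n.
pose s := ln 2 / r ^+ 2.
have s0 : 0 < s by rewrite divr_gt0// exprn_gt0.
have msub : measurable_fun setT (fun u : R => u - y) by apply: measurable_funB.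
have mw : measurable_fun setT w.
  by apply/measurable_EFinP; exact: (measurable_int mu iw).
have := @integral_level_set_eq0 _ _ R mu w
  (fun u => expR (- (s * (u - y) ^+ 2))) iw.
have -> : [set u | 1 / 2 <= expR (- (s * (u - y) ^+ 2))] =
    [set` `[y - r, y + r]].
  apply/seteqP; split => u /=;
    rewrite expRN div1r lef_pV2 ?posrE ?expR_gt0// -[leRHS]lnK ?posrE//;
    rewrite ler_expR /s mulrAC ler_pdivrMr ?exprn_gt0// ler_pM2l// in_itv/=;
    rewrite -(real_normK (num_real (u - y))) ler_sqr ?nnegrE ?(ltW r0)//;
    by rewrite ler_norml lerBrDr (lerBlDr u) (addrC (- r)) (addrC r).
move=> /(_ _ _ _)/wrap[].
- apply: measurableT_comp => //; apply: measurableT_comp => //.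
  by apply: measurable_funM => //; exact: measurable_funX.
- by move=> u; rewrite expR_ge0 expR_le1 oppr_le0 mulr_ge0 ?sqr_ge0// ltW.
- move=> n; rewrite -(w0 (n%:R * s)); last by rewrite mulr_ge0// ltW.
  by apply: eq_Rintegral => u _; rewrite -expRM_natl mulrN mulrA.
rewrite ball_itv => I0.
rewrite integral_itv_bndo_bndc ?integral_itv_obnd_cbnd//; last 2 first.
- by apply/measurable_EFinP; exact: measurable_funS mw.
- by apply/measurable_EFinP; exact: measurable_funS mw.
rewrite -[LHS]fineK; first by congr EFin; exact: I0.
by apply: integrable_fin_num => //; exact: integrableS iw.
Qed.

Lemma ae_eq0_of_integral_ball w : mu.-integrable setT (EFin \o w) ->
  (forall y r, 0 < r -> (\int[mu]_(u in ball y r) (w u)%:E = 0)%E) ->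
  {ae mu, forall x, w x = 0}.
Proof.
move=> iw w0; pose E (x : R) (n : nat) : set R := ball x (n.+1%:R^-1).
have nE x : nicely_shrinking x (E x).
  split; first by move=> n; exact: measurable_ball.
  exists (1, fun n => PosNum (ltac:(by rewrite invr_gt0 ltr0n) : 0 < n.+1%:R^-1 :> R)).
  split => //=; [exact: cvg_harmonic|by move=> n|by move=> n; rewrite mul1e].
have lw : locally_integrable setT w.
  by apply: open_integrable_locally => //; exact: openT.
have := lebesgue_differentiation lw.
apply: filterS; first exact: (ae_filter_ringOfSetsType mu).
move=> x lx.
have := nice_lebesgue_differentiation nE lw lx.
under eq_fun do rewrite w0 ?invr_gt0// mule0.
by move=> h; have [] : (w x)%:E = 0%E by exact: cvg_unique h (cvg_cst _).
Qed.

(** exp(- s (u - y)^2) is the product of exp(- s (u - a)^2), an exponential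
    of a multiple of u - a, and a constant. *)
Lemma gauss_null_ae_eq0 a e w : 0 < e ->
  gauss_null mu (fun u => u - a) e w -> {ae mu, forall x, w x = 0}.
Proof.
move=> e0 H; have mv : measurable_fun setT (fun u : measurableTypeR R => u - a : R).
  by apply: measurable_funB.
have iw : mu.-integrable setT (EFin \o w).
  have := integrable_gauss_null_moment mv 0 e0 H.
  by under [in X in integrable _ _ X]eq_fun do rewrite expr0 mulr1.
apply: ae_eq0_of_integral_ball => // y r r0; apply: integral_ball_eq0 => // s s0.
have := gauss_null_exp_transform mv (2 * s * (y - a)) e0 s0 H.
move=> /(congr1 ( *%R (expR (- (s * (y - a) ^+ 2))))).
rewrite mulr0 -RintegralZl//.
  move=> <-; apply: eq_Rintegral => u _.
  by rewrite -(mulrA (w u)) -expRD (mulrCA _ (w u)) -expRD; congr (_ * expR _); ring.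
have [mW iW _] := gauss_null_expR mv e0 s0 H.
have := integrable_gauss_moment mv 0 e0 (normr_ge0 (2 * s * (y - a))) mW iW.
move=> iW2; apply: integrable_dominated (integrable_normr iW2) _.
  apply: measurable_funM => //; apply: measurableT_comp => //.
  exact: measurable_funM.
move=> u; rewrite expr0 mulr1 [leLHS]normrM [leRHS]normrM ler_wpM2l//.
rewrite !(ger0_norm (expR_ge0 _)) ler_expR.
by rewrite (le_trans (ler_norm _))// normrM.
Qed.

End determinacy.

(** * Translations, reflections and the normal density *)

Section measure_preserving.
Context {R : realType}.
Notation mu := (@lebesgue_measure R).
Notation rT := (measurableTypeR R).
Variable phi : rT -> rT.
Hypothesis mphi : measurable_fun setT phi.
Hypothesis phi_mu : forall A, measurable A -> pushforward mu phi A = mu A.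

Lemma ge0_integral_preserved (f : R -> \bar R) : measurable_fun setT f ->
  (forall x, 0 <= f x)%E -> (\int[mu]_x f (phi x) = \int[mu]_x f x)%E.
Proof.
move=> mf f0.
have := @ge0_integral_pushforward _ _ rT rT R _ mphi mu setT f measurableT mf
  (fun x _ => f0 x).
rewrite preimage_setT => <-.
by apply: eq_measure_integral => A mA _; exact: phi_mu.
Qed.

Lemma integrable_preserved (f : R -> R) : measurable_fun setT f ->
  mu.-integrable setT (EFin \o (fun x => f (phi x))) <->
  mu.-integrable setT (EFin \o f).
Proof.
move=> mf; have e : (\int[mu]_x `|(f (phi x))%:E| = \int[mu]_x `|(f x)%:E|)%E.
  rewrite (ge0_integral_preserved (f := fun x => `|(f x)%:E|%E))//.
  by apply: measurableT_comp => //; exact/measurable_EFinP.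
have mfphi : measurable_fun setT (fun x => f (phi x)).
  exact: measurableT_comp.
split=> /integrableP[_ fi]; apply/integrableP; split.
- exact/measurable_EFinP.
- by rewrite -e.
- exact/measurable_EFinP.
- by rewrite e.
Qed.

Lemma Rintegral_preserved (f : R -> R) : measurable_fun setT f ->
  mu.-integrable setT (EFin \o f) ->
  \int[mu]_x f (phi x) = \int[mu]_x f x.
Proof.
move=> mf fi; have mEf : measurable_fun setT (EFin \o f) by exact/measurable_EFinP.
have := @integral_pushforward _ _ rT rT R _ mphi mu setT (EFin \o f) mEf.
rewrite preimage_setT => /(_ ((integrable_preserved mf).2 fi) measurableT) h.
rewrite /Rintegral; congr fine; rewrite -[LHS]h.
by apply: eq_measure_integral => A mA _; exact: phi_mu.
Qed.

End measure_preserving.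

Section gaussian_shift.
Context {R : realType}.
Notation mu := (@lebesgue_measure R).
Notation rT := (measurableTypeR R).
Implicit Types (f : R -> R) (t x u : R).

Lemma measurable_addr_cst t : measurable_fun setT (fun x : rT => x + t : rT).
Proof. by apply: measurable_funD. Qed.

Lemma lebesgue_measure_shift t (A : set R) : measurable A ->
  pushforward mu (fun x : rT => x + t : rT) A = mu A.
Proof.
have mt := measurable_addr_cst t.
move=> mA; apply/esym/lebesgue_measure_unique => //= _ [[a b]] _ <-.
rewrite /pushforward.
have -> : (fun x : rT => x + t : rT) @^-1` [set` `]a, b]] =
    [set` `]a - t, b - t]].
  by apply/seteqP; split => x /=; rewrite !in_itv/= ltrBlDr lerBrDr.
rewrite !lebesgue_measure_itv/= !lte_fin ltrD2r; case: ifP => // _.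
by rewrite -!EFinB opprB addrA subrK.
Qed.

Lemma normal_pdf1E x u : normal_pdf x 1 u =
  normal_peak (1 : R) * expR (- ((u - x) ^+ 2 / 2)).
Proof. by rewrite normal_pdfE ?oner_neq0// /normal_fun expr1n mulNr. Qed.

Lemma normal_pdf_shift x u : normal_pdf x 1 (u + x) = normal_pdf 0 1 u :> R.
Proof. by rewrite !normal_pdf1E addrK subr0. Qed.

(** Translating the mean is an exponential tilt; this turns the dependence
    on t into that of an exponential transform. *)
Lemma normal_pdf_tilt x t u : normal_pdf (x + t) 1 u =
  normal_pdf x 1 u * expR (t * (u - x)) * expR (- (t ^+ 2 / 2)) :> R.
Proof.
by rewrite !normal_pdf1E -!mulrA -!expRD; congr (_ * expR _); field.
Qed.

(** Up to a constant, the product is the density of variance 2. *)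
Lemma integrable_normal_pdf_gauss x : mu.-integrable setT
  (EFin \o (fun u => normal_pdf x 1 u * expR (1 / 4 * (u - x) ^+ 2))).
Proof.
have s2 : Num.sqrt 2 != 0 :> R by rewrite gt_eqF// sqrtr_gt0.
have := integrableZl measurableT (normal_peak (1 : R) / normal_peak (Num.sqrt 2))
  (@integrable_normal_pdf R x (Num.sqrt 2)).
congr (integrable _ _ _); apply/funext => u /=; rewrite -EFinM; congr EFin.
rewrite normal_pdf1E normal_pdfE// /normal_fun sqr_sqrtr// mulrA divfK.
  by rewrite -[RHS]mulrA -expRD; congr (_ * expR _); field.
by rewrite gt_eqF// normal_peak_gt0.
Qed.

Lemma integrable_normal_pdf_moment x n :
  mu.-integrable setT (EFin \o (fun u => normal_pdf x 1 u * (u - x) ^+ n)).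
Proof.
have e0 : 0 < 1 / 4 :> R by lra.
have := @integrable_gauss_moment _ rT R mu (fun u => u - x)
  (measurable_addr_cst (- x)) (normal_pdf x 1) (1 / 4) 0 n e0 (lexx 0)
  (measurable_normal_pdf _ _) (integrable_normal_pdf_gauss x).
by under [in X in integrable _ _ X -> _]eq_fun do rewrite mul0r expR0 mulr1.
Qed.

Lemma normal_pdf_mean0 : \int[mu]_u (u * normal_pdf 0 1 u) = 0.
Proof.
have mN : measurable_fun setT (fun u : rT => - u : rT) by apply: oppr_measurable.
have mf : measurable_fun setT (fun u : R => u * normal_pdf 0 1 u).
  by apply: measurable_funM => //; exact: measurable_normal_pdf.
have fi : mu.-integrable setT (EFin \o (fun u => u * normal_pdf 0 1 u)).
  have := integrable_normal_pdf_moment (0 : R) 1.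
  by under [in X in integrable _ _ X -> _]eq_fun do rewrite expr1 subr0 mulrC.
have := Rintegral_preserved mN (@lebesgue_measureN R) mf fi.
have -> : \int[mu]_u (- u * normal_pdf 0 1 (- u)) =
    - 1 * \int[mu]_u (u * normal_pdf 0 1 u).
  rewrite -RintegralZl//; apply: eq_Rintegral => u _.
  by rewrite !normal_pdf1E !subr0 sqrrN; ring.
lra.
Qed.

Lemma ge0_integral_normal_prob (f : R -> \bar R) : measurable_fun setT f ->
  (forall x, 0 <= f x)%E ->
  (\int[normal_prob (0 : R) 1]_x f x = \int[mu]_x (f x * (normal_pdf 0 1 x)%:E))%E.
Proof.
move=> mf f0; have dom := @normal_prob_dominates R 0 1.
rewrite -(Radon_Nikodym_SigmaFinite.change_of_variables dom)//.
have mp : measurable_fun setT (EFin \o normal_pdf (0 : R) 1).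
  by apply/measurable_EFinP; exact: measurable_normal_pdf.
have iRN := Radon_Nikodym_SigmaFinite.f_integrable dom.
apply: ae_eq_integral => //.
- by apply: emeasurable_funM => //; exact: measurable_int iRN.
- exact: emeasurable_funM.
- apply: ae_eqe_mul2l; apply: integral_ae_eq => // E _ mE.
  by rewrite -Radon_Nikodym_SigmaFinite.f_integral.
Qed.

Lemma integral_normal_prob (f : R -> R) : measurable_fun setT f ->
  (\int[normal_prob (0 : R) 1]_x (f x)%:E =
   \int[mu]_x (f x * normal_pdf 0 1 x)%:E)%E.
Proof.
move=> mf; have mE : measurable_fun setT (EFin \o f) by exact/measurable_EFinP.
have mp x : (fun y : R => Order.max y 0 * normal_pdf (0 : R) 1 x) =1
    (fun y => Order.max (y * normal_pdf 0 1 x) 0).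
  by move=> y; rewrite maxr_pMl ?normal_pdf_ge0// mul0r.
rewrite [LHS]integralE [RHS]integralE.
congr (_ - _)%E.
- rewrite ge0_integral_normal_prob//; last exact: measurable_funepos.
  apply: eq_integral => x _; rewrite !funeposE /=.
  by rewrite -!EFin_max -EFinM mp.
- rewrite ge0_integral_normal_prob//; last exact: measurable_funeneg.
  apply: eq_integral => x _; rewrite !funenegE /=.
  by rewrite -!EFin_max -EFinM mp mulNr.
Qed.

Lemma hermite1 x : hermite 1 x = x.
Proof.
rewrite /hermite derive1n1 derive1E.
have h : is_derive x 1 (fun y : R => expR (- (y ^+ 2 / 2)))
    (- x * expR (- (x ^+ 2 / 2))).
  apply: is_derive_eq; rewrite !scaler0 add0r /GRing.scale/=.
  by rewrite mulrC; congr (_ * _); field.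
by rewrite derive_val expr1 mulN1r mulrCA !mulNr mulrN expRxMexpNx_1; ring.
Qed.

End gaussian_shift.

(** * Accumulating zeros annihilate all moments *)

Section moment_recursion.
Context {d : measure_display} {T : measurableType d} {R : realType}.
Variable mu : {measure set T -> \bar R}.
Variables w v : T -> R.
Hypotheses (mw : measurable_fun setT w) (mv : measurable_fun setT v).
Hypothesis iwv : mu.-integrable setT (EFin \o (fun x => w x * expR `|v x|)).
Hypothesis iwvv :
  mu.-integrable setT (EFin \o (fun x => w x * v x * expR `|v x|)).

(** Write m_n for the moments. If m_0, ..., m_n vanish then the integral of
    w v exp(t v) is t^n m_(n+1) / n! up to O(t^(n+1)), while that of w exp(t v)
    is O(t^(n+1)). At the given t the former is t times the latter, so that
    m_(n+1) = O(t), and t may be taken arbitrarily small. *)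
Lemma moments_eq0_of_accumulation : \int[mu]_x w x = 0 ->
  (forall e : R, 0 < e -> exists t, [/\ t != 0, `|t| < e &
     \int[mu]_x (w x * (v x - t) * expR (t * v x)) = 0]) ->
  forall n, \int[mu]_x (w x * v x ^+ n) = 0.
Proof.
move=> w0 wt.
have mwv : measurable_fun setT (fun x => w x * v x) by exact: measurable_funM.
pose CA := \int[mu]_x `|w x * v x * expR `|v x| |.
pose CB := \int[mu]_x `|w x * expR `|v x| |.
have CA0 : 0 <= CA by exact: Rintegral_ge0.
have CB0 : 0 <= CB by exact: Rintegral_ge0.
elim/ltn_ind => -[_|n IH].
  by rewrite -w0; apply: eq_Rintegral => x _; rewrite expr0 mulr1.
set m := \int[mu]_x _; apply/eqP/negPn/negP => m0.
(* The second bound is what makes (CA + CB) |t| smaller than |m| / n!. *)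
pose e := Order.min 1 (`|m| / n`!%:R / (CA + CB + 1)).
have e0 : 0 < e.
  rewrite lt_min ltr01 /= !divr_gt0 ?normr_gt0// ?ltr0n ?fact_gt0//.
  by rewrite ltr_wpDl// addr_ge0.
have [t [t0 te wt0]] := wt _ e0.
have t1 : `|t| <= 1.
  by apply: ltW; apply: lt_le_trans te _; rewrite ge_min lexx.
have tp : 0 < `|t| by rewrite normr_gt0.
have AB : \int[mu]_x (w x * v x * expR (t * v x)) =
    t * \int[mu]_x (w x * expR (t * v x)).
  have iA := integrable_exp_weight mwv mv iwvv t1.
  have iB := integrable_exp_weight mw mv iwv t1.
  have iB' := integrableZl measurableT t iB.
  apply/eqP; rewrite -subr_eq0 -RintegralZl// -RintegralB// -[X in _ == X]wt0.
  by apply/eqP; apply: eq_Rintegral => x _; ring.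
have := exp_moment_expansion mw mv iwv n.+1 t1.
rewrite big1 ?subr0 => [hB|k _]; last by rewrite IH ?mulr0.
have mS k : \int[mu]_x (w x * v x * v x ^+ k) = \int[mu]_x (w x * v x ^+ k.+1).
  by apply: eq_Rintegral => x _; rewrite -mulrA -exprS.
have := exp_moment_expansion mwv mv iwvv n.+1 t1.
rewrite big_ord_recr/= big1 ?add0r => [|k _]; last by rewrite mS IH ?mulr0// ltnS.
rewrite mS -/m.
rewrite AB => hA.
have : `|t ^+ n / n`!%:R * m| <= `|t| ^+ n.+1 * (CA + CB).
  rewrite -(subrK (t * \int[mu]_x (w x * expR (t * v x))) (t ^+ n / n`!%:R * m)).
  rewrite (le_trans (ler_normD _ _))// mulrDr lerD//; first by rewrite distrC.
  rewrite normrM (le_trans _ hB)// ler_piMl//.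
rewrite !normrM normfV normr_nat normrX exprSr -!mulrA ler_pM2l ?exprn_gt0//.
rewrite leNgt => /negP; apply.
have : `|t| < `|m| / n`!%:R / (CA + CB + 1).
  by apply: lt_le_trans te _; rewrite ge_min lexx orbT.
rewrite ltr_pdivlMr ?ltr_wpDl ?addr_ge0// [_^-1 * _]mulrC; apply: le_lt_trans.
by rewrite ler_wpM2l// lerDl.
Qed.

End moment_recursion.

(** * Shifts of a square-integrable function *)

Section square_integrable.
Context {R : realType}.
Notation mu := (@lebesgue_measure R).
Notation rT := (measurableTypeR R).
Variable G : R -> R.
Hypothesis mG : measurable_fun setT G.
Implicit Types (c t x : R).

(** Square-integrability of [shift_fun G x] under N(0, 1), read as that
    of [G] under N(x, 1): the function is then the same for all [x]. *)
Definition normal_L2 x :=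
  mu.-integrable setT (EFin \o (fun u => G u ^+ 2 * normal_pdf x 1 u)).

Lemma L2_gaussian_shiftE x : L2_gaussian (shift_fun G x) <-> normal_L2 x.
Proof.
have mx := measurable_addr_cst x.
pose F u := G u ^+ 2 * normal_pdf x 1 u.
have F0 u : 0 <= F u by rewrite mulr_ge0 ?sqr_ge0 ?normal_pdf_ge0.
have mF : measurable_fun setT F.
  by apply: measurable_funM; [exact: measurable_funX|exact: measurable_normal_pdf].
have FE : (\int[mu]_z (shift_fun G x z ^+ 2 * normal_pdf 0 1 z)%:E =
    \int[mu]_u (F u)%:E)%E.
  rewrite -(ge0_integral_preserved mx (lebesgue_measure_shift x)
    (f := fun u => (F u)%:E)) => [| |u]; last by rewrite lee_fin.
    by apply: eq_integral => z _; rewrite /F normal_pdf_shift.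
  exact/measurable_EFinP.
have nF : (\int[mu]_u `|(F u)%:E| = \int[mu]_u (F u)%:E)%E.
  by apply: eq_integral => u _; rewrite gee0_abs ?lee_fin.
rewrite /L2_gaussian FE; split=> [[_ fF]|/integrableP[_]].
  apply/integrableP; split; first exact/measurable_EFinP.
  by rewrite nF.
by rewrite nF; split => //; exact: measurableT_comp.
Qed.

(** Since exp(u x) is at most exp(u M) + exp(- u M). *)
Lemma normal_pdf_interpolation (M x u : R) : `|x| <= M ->
  normal_pdf x 1 u <=
  expR (M ^+ 2 / 2) * (normal_pdf M 1 u + normal_pdf (- M) 1 u).
Proof.
move=> xM; rewrite !normal_pdf1E -mulrDr mulrCA ler_wpM2l ?normal_peak_ge0//.
rewrite mulrDr -!expRD.
have [u0|u0] := leP 0 u.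
  rewrite -[leLHS]addr0 lerD ?expR_ge0// ler_expR.
  have := ler_wpM2l u0 (le_trans (ler_norm x) xM).
  by have := sqr_ge0 x; rewrite -subr_ge0; nra.
rewrite -[leLHS]add0r lerD ?expR_ge0// ler_expR.
have : - M <= x by rewrite lerNl (le_trans _ xM)// -normrN ler_norm.
move=> /(ler_wnM2l (ltW u0)).
have := sqr_ge0 x; nra.
Qed.

Lemma normal_L2_between (M x : R) :
  normal_L2 M -> normal_L2 (- M) -> `|x| <= M -> normal_L2 x.
Proof.
move=> iM iN xM.
have := integrableZl measurableT (expR (M ^+ 2 / 2)) (integrableD measurableT iM iN).
move=> iS.
apply: (@integrable_dominated _ rT _ _ _ (fun u => expR (M ^+ 2 / 2) *
   (G u ^+ 2 * normal_pdf M 1 u + G u ^+ 2 * normal_pdf (- M) 1 u)) _ iS).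
  by apply: measurable_funM; [exact: measurable_funX|exact: measurable_normal_pdf].
move=> u; rewrite ger0_norm; last by rewrite mulr_ge0 ?sqr_ge0 ?normal_pdf_ge0.
rewrite -mulrDr mulrCA ler_wpM2l ?sqr_ge0//.
exact: normal_pdf_interpolation.
Qed.

Definition centered_weight c x := fun u : rT => (G u - c) * normal_pdf x 1 u : R.

Lemma measurable_centered_weight c x : measurable_fun setT (centered_weight c x).
Proof.
apply: measurable_funM; last exact: measurable_normal_pdf.
exact: measurable_funB.
Qed.

(** By Young's inequality, |G - c| exp(v^2/8) is at most
    (G - c)^2 + exp(v^2/4), and both terms are integrable. *)
Lemma integrable_centered_weight c x : normal_L2 x -> mu.-integrable setT
  (EFin \o (fun u => centered_weight c x u * expR (1 / 8 * (u - x) ^+ 2))).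
Proof.
move=> ix.
have i1 := integrableZl measurableT 2 ix.
have i2 := integrableZl measurableT (2 * c ^+ 2) (@integrable_normal_pdf R x 1).
have i3 := integrableD measurableT (integrableD measurableT i1 i2)
  (integrable_normal_pdf_gauss x).
apply: (@integrable_dominated _ rT _ _ _ (fun u =>
    2 * (G u ^+ 2 * normal_pdf x 1 u) + 2 * c ^+ 2 * normal_pdf x 1 u +
    normal_pdf x 1 u * expR (1 / 4 * (u - x) ^+ 2)) _ i3).
  apply: measurable_funM; first exact: measurable_centered_weight.
  apply: measurableT_comp => //; apply: measurable_funM => //.
  by apply: measurable_funX; exact: measurable_addr_cst.
move=> u; rewrite /centered_weight mulrAC normrM.
rewrite (ger0_norm (normal_pdf_ge0 _ _ _)).
rewrite [leRHS](_ : _ = (2 * G u ^+ 2 + 2 * c ^+ 2 +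
  expR (1 / 4 * (u - x) ^+ 2)) * normal_pdf x 1 u); last by ring.
rewrite ler_wpM2r ?normal_pdf_ge0//.
rewrite (_ : 1 / 4 * _ = 1 / 8 * (u - x) ^+ 2 + 1 / 8 * (u - x) ^+ 2); last by field.
rewrite expRD normrM (ger0_norm (expR_ge0 _)).
set E := expR _; set a := G u.
have h : `|a - c| ^+ 2 <= 2 * a ^+ 2 + 2 * c ^+ 2.
  by rewrite real_normK ?num_real//; have := sqr_ge0 (a + c); nra.
apply: (@le_trans _ _ (`|a - c| ^+ 2 + E * E)); last by rewrite lerD2r.
have := sqr_ge0 (`|a - c| - E).
have := sqr_ge0 (`|a - c|); have := sqr_ge0 E; nra.
Qed.

Lemma integrable_centered_weight_moment c x n k : 0 <= k -> normal_L2 x ->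
  mu.-integrable setT (EFin \o
    (fun u => centered_weight c x u * (u - x) ^+ n * expR (k * `|u - x|))).
Proof.
move=> k0 ix; have e0 : 0 < 1 / 8 :> R by lra.
exact: (integrable_gauss_moment (measurable_addr_cst (- x)) n e0 k0
  (measurable_centered_weight c x) (integrable_centered_weight c ix)).
Qed.

Lemma hermite_rank_ge2 (f : R -> R) : (2%:E <= hermite_rank f)%E ->
  (\int[normal_prob (0 : R) 1]_x (f x * x)%:E = 0)%E.
Proof.
move=> f2; apply: contrapT => f0; move: f2; apply/negP; rewrite -ltNge.
apply: (@le_lt_trans _ _ 1%:E); last by rewrite lte_fin ltr1n.
apply: ereal_inf_lbound; exists 1%N => //; split => //.
by under eq_integral do rewrite hermite1.
Qed.

(** The constant [c] may be subtracted because [H_1] has mean 0. *)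
Lemma rank_ge2_first_moment c x : normal_L2 x ->
  (2%:E <= hermite_rank (shift_fun G x))%E ->
  \int[mu]_u (centered_weight c x u * (u - x)) = 0.
Proof.
move=> ix /hermite_rank_ge2 h.
have mx := measurable_addr_cst x.
have mc k : measurable_fun setT (fun u : rT => centered_weight k x u * (u - x)).
  apply: measurable_funM; first exact: measurable_centered_weight.
  exact: measurable_addr_cst.
have ic k : mu.-integrable setT
    (EFin \o (fun u => centered_weight k x u * (u - x))).
  have := integrable_centered_weight_moment k 1 (lexx 0) ix.
  by under [in X in integrable _ _ X -> _]eq_fun do rewrite mul0r expR0 mulr1 expr1.
have ms := lebesgue_measure_shift x.
have is0 := (integrable_preserved mx ms (mc 0)).2 (ic 0).
rewrite -(Rintegral_preserved mx ms (mc c) (ic c)).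
have iz : mu.-integrable setT (EFin \o (fun z => z * normal_pdf 0 1 z)).
  have := integrable_normal_pdf_moment (0 : R) 1.
  by under [in X in integrable _ _ X -> _]eq_fun do rewrite expr1 subr0 mulrC.
have icz := integrableZl measurableT c iz.
transitivity (\int[mu]_z (centered_weight 0 x (z + x) * (z + x - x) -
    c * (z * normal_pdf 0 1 z))).
  by apply: eq_Rintegral => z _; rewrite /centered_weight addrK normal_pdf_shift; ring.
rewrite RintegralB// RintegralZl// normal_pdf_mean0 mulr0 subr0.
rewrite integral_normal_prob in h; last first.
  by apply: measurable_funM => //; exact: measurableT_comp.
rewrite /Rintegral -[RHS]/(fine 0%E) -h; congr fine; apply: eq_integral => z _.
by rewrite /centered_weight /shift_fun addrK normal_pdf_shift subr0 mulrAC.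
Qed.

End square_integrable.

(** * Accumulation of shifts with rank at least 2 *)

Lemma rank_ge2_accumulation_ae_cst (R : realType) (G : R -> R)
    (mG : measurable_fun [set: R] G) (x0 : R) : normal_L2 G x0 ->
  (forall e : R, 0 < e -> exists t, [/\ t != 0, `|t| < e, normal_L2 G (x0 + t) &
     (2%:E <= hermite_rank (shift_fun G (x0 + t)))%E]) ->
  exists c : R, {ae lebesgue_measure, forall x : R, G x = c}.
Proof.
move=> ix0 rank_near; pose mu := @lebesgue_measure R.
pose c := \int[mu]_u (G u * normal_pdf x0 1 u); exists c.
pose w := centered_weight G c x0.
have mw := measurable_centered_weight mG c x0.
have mv := measurable_addr_cst (- x0).
have imom n k := integrable_centered_weight_moment mG c n (k := k) ^~ ix0.
have w0 : \int[mu]_u w u = 0.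
  have ip := @integrable_normal_pdf R x0 1.
  have iG : mu.-integrable setT (EFin \o (fun u => G u * normal_pdf x0 1 u)).
    have := integrable_centered_weight_moment mG 0 0 (lexx 0) ix0.
    under [in X in integrable _ _ X -> _]eq_fun do
      rewrite mul0r expR0 mulr1 expr0 mulr1 /centered_weight subr0.
    by [].
  transitivity (\int[mu]_u (G u * normal_pdf x0 1 u - c * normal_pdf x0 1 u)).
    by apply: eq_Rintegral => u _; rewrite /w /centered_weight mulrBl.
  rewrite RintegralB//; last exact: (integrableZl measurableT c ip).
  rewrite RintegralZl// -/c [X in _ * X](_ : _ = 1) ?mulr1 ?subrr//.
  by rewrite /Rintegral integral_normal_pdf.
have moments : forall n, \int[mu]_u (w u * (u - x0) ^+ n) = 0.
  apply: (moments_eq0_of_accumulation mw mv) => //.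
  - have := imom 0%N 1 ler01.
    by under [in X in integrable _ _ X -> _]eq_fun do rewrite mul1r expr0 mulr1.
  - have := imom 1%N 1 ler01.
    by under [in X in integrable _ _ X -> _]eq_fun do rewrite mul1r expr1.
  move=> e /rank_near[t [t0 te it rt]]; exists t; split => //.
  have it1 : mu.-integrable setT
      (EFin \o (fun u => centered_weight G c (x0 + t) u * (u - (x0 + t)))).
    have := integrable_centered_weight_moment mG c 1 (lexx 0) it.
    by under [in X in integrable _ _ X -> _]eq_fun do
      rewrite mul0r expR0 mulr1 expr1.
  rewrite -[RHS](mulr0 (expR (t ^+ 2 / 2))) -(rank_ge2_first_moment mG c it rt).
  rewrite -RintegralZl//; apply: eq_Rintegral => u _.
  rewrite /w /centered_weight normal_pdf_tilt opprD addrA.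
  rewrite [RHS](_ : _ = (G u - c) * normal_pdf x0 1 u * (u - x0 - t) *
    expR (t * (u - x0)) * (expR (t ^+ 2 / 2) * expR (- (t ^+ 2 / 2)))); last by ring.
  by rewrite expRxMexpNx_1 mulr1.
have e0 : 0 < 1 / 8 :> R by lra.
have := gauss_null_ae_eq0 e0 (And3 mw (integrable_centered_weight mG c ix0) moments).
apply: filterS; first exact: (ae_filter_ringOfSetsType mu).
move=> u /eqP; rewrite /centered_weight mulf_eq0 subr_eq0 => /orP[/eqP//|].
by rewrite normal_pdf1E mulf_eq0 expR_eq0 orbF gt_eqF// normal_peak_gt0.
Qed.

Theorem theorem2p1 (R : realType) (G : R -> R) (M : R)
    (mG : measurable_fun [set: R] G)
    (G_not_cst : ~ exists c : R, {ae lebesgue_measure, forall x : R, G x = c})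
    (M_gt0 : 0 < M)
    (G_right : L2_gaussian (shift_fun G M))
    (G_left : L2_gaussian (shift_fun G (- M))) :
  (forall x : R, x \in `[- M, M] -> L2_gaussian (shift_fun G x)) /\
  accumulation_points
    [set x : R | (x \in `]- M, M[) /\
                 (2%:E <= hermite_rank (shift_fun G x))%E]
    `&` [set` `]- M, M[] = set0.
Proof.
have L2 x : x \in `[- M, M] -> normal_L2 G x.
  rewrite in_itv/= -ler_norml => xM.
  by apply: (@normal_L2_between _ _ mG M) => //; exact/L2_gaussian_shiftE.
split=> [x /L2|]; first by move/L2_gaussian_shiftE; exact.
rewrite -subset0 => x0 [/= x0_acc x0M]; apply: G_not_cst.
apply: (rank_ge2_accumulation_ae_cst mG (x0 := x0)).
  by apply: L2; exact: subset_itv_oo_cc x0M.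
move=> e e0; apply: contrapT => no_t.
have x0B : nbhs x0 (ball x0 e) by exact: nbhsx_ballx.
apply: (x0_acc _ x0B); apply: sub_finite_set (finite_set1 x0).
move=> x [/= x0x [xM rx]]; apply: contrapT => xx0; apply: no_t.
exists (x - x0); rewrite (addrC x0) subrK; split => //.
- by rewrite subr_eq0; exact/eqP.
- by move: x0x; rewrite /ball/= distrC.
- by apply: L2; exact: subset_itv_oo_cc xM.
Qed.
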